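(* Let $\mathsf{P}:\mathsf{Set}^{\mathrm{op}}\to\mathsf{Hey}$ be an implicative tripos. Then an object $(A,\alpha)$ of $\mathbf{Reg}_{\mathsf{P}}$ is strongly trackable if and only if $\alpha$ is a functionally supercompact ($\mathbf{fSK_p}$) predicate of $\mathsf{P}$.
   Context: Implicative algebras. An implicative algebra $\mathbb{A}=(\mathcal{A},\leq,\to,\Sigma)$ is a complete lattice $(\mathcal{A},\leq)$ with a binary operation $\to$ (associating to the right) such that (i) $a'\leq a$ and $b\leq b'$ imply $a\to b\leq a'\to b'$, and (ii) $a\to\bigwedge_{b\in B}b=\bigwedge_{b\in B}(a\to b)$ for all $a\in\mathcal{A}$, $B\subseteq\mathcal{A}$; together with a separator $\Sigma\subseteq\mathcal{A}$, i.e. a subset that is upward closed, contains $\bigwedge_{a,b}(a\to b\to a)$ and $\bigwedge_{a,b,c}((a\to b\to c)\to(a\to b)\to a\to c)$, and satisfies: $a\to b\in\Sigma$ and $a\in\Sigma$ imply $b\in\Sigma$. Define $a\times b:=\bigwedge_{x\in\mathcal{A}}((a\to(b\to x))\to x)$ and $\exists_{i\in I}c_i:=\bigwedge_{x\in\mathcal{A}}(\bigwedge_{i\in I}(c_i\to x)\to x)$. Implicative tripos (of $\mathbb{A}$). For a set $I$, $\mathsf{P}(I)$ is the posetal reflection of $\mathcal{A}^I$ preordered by: $\varphi\vdash\psi$ iff $\bigwedge_{i\in I}(\varphi(i)\to\psi(i))\in\Sigma$. It is a Heyting algebra with order written $\leq$ and meet $\wedge$ (represented by the pointwise $\times$). For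 $f:I\to X$, $\mathsf{P}_f:\mathsf{P}(X)\to\mathsf{P}(I)$ is precomposition with $f$; its left adjoint $\exists_f$ is represented by $(\exists_f\varphi)(x)=\exists_{i\in f^{-1}(x)}\varphi(i)$. For a set $X$ with diagonal $\Delta_X$, $\delta_X:=\exists_{\Delta_X}(\top)\in\mathsf{P}(X\times X)$. Functional predicates. A predicate $\phi\in\mathsf{P}(I\times J)$ is functional if $\mathsf{P}_{\langle\pi_1,\pi_2\rangle}(\phi)\wedge\mathsf{P}_{\langle\pi_1,\pi_3\rangle}(\phi)\leq\mathsf{P}_{\langle\pi_2,\pi_3\rangle}(\delta_J)$, the projections being from $I\times J\times J$. A predicate $\varphi\in\mathsf{P}(I)$ is functionally supercompact ($\mathbf{fSK_p}$) if for every set $J$ and every functional $\phi\in\mathsf{P}(I\times J)$ with $\varphi\leq\exists_{\pi_I}(\phi)$ there is a unique function $f:I\to J$ with $\varphi\leq\mathsf{P}_{\langle\mathrm{id}_I,f\rangle}(\phi)$. The category $\mathbf{Reg}_{\mathsf{P}}$. Objects are pairs $(A,\alpha)$ with $A$ a set and $\alpha\in\mathsf{P}(A)$. An arrow $(A,\alpha)\to(B,\beta)$ is an element $\phi\in\mathsf{P}(A\times B)$ such that (1) $\phi\leq\mathsf{P}_{\pi_1}(\alpha)\wedge\mathsf{P}_{\pi_2}(\beta)$; (2) $\alpha\leq\exists_{\pi_1}(\phi)$; (3) $\phi$ is functional. Composition of $\phi:(A,\alpha)\to(B,\beta)$ and $\psi:(B,\beta)\to(C,\gamma)$ is $\exists_{\langle\pi_1,\pi_3\rangle}(\mathsf{P}_{\langle\pi_1,\pi_2\rangle}(\phi)\wedge\mathsf{P}_{\langle\pi_2,\pi_3\rangle}(\psi))$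 (projections from $A\times B\times C$); the identity of $(A,\alpha)$ is $\exists_{\Delta_A}(\alpha)$. Strong trackability. An arrow $\phi:(A,\alpha)\to(B,\beta)$ of $\mathbf{Reg}_{\mathsf{P}}$ is strongly trackable if there is a unique function $f_\phi:A\to B$ with $\alpha\leq\mathsf{P}_{\langle\mathrm{id}_A,f_\phi\rangle}(\phi)$. An object $(A,\alpha)$ is strongly trackable if every arrow of $\mathbf{Reg}_{\mathsf{P}}$ with domain $(A,\alpha)$ is strongly trackable. *)

(* Defs.v *)
From HB Require Import structures.
From mathcomp Require Import all_boot all_order.
From mathcomp Require Import boolp classical_sets.

Set Implicit Arguments.
Unset Strict Implicit.
Unset Printing Implicit Defensive.

Import Order.TTheory.
Local Open Scope classical_set_scope.
Local Open Scope order_scope.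

(* A single universe of sets, so that the index sets of the tripos, the
   carriers of the objects of [Reg P] and the sets quantified over in functional
   supercompactness all range over the same collection. *)
Definition SET := Type.

HB.mixin Record POrder_isComplete d T of Order.POrder d T := {
  inf : set T -> T;
  inf_lb : forall (B : set T) b, B b -> inf B <= b;
  inf_glb : forall (B : set T) a, (forall b, B b -> a <= b) -> a <= inf B;
}.

#[short(type="completeLatticeType")]
HB.structure Definition CompleteLattice d :=
  { T of POrder_isComplete d T & Order.POrder d T }.

HB.mixin Record CompleteLattice_isImplicative d T of CompleteLattice d T := {
  imp : T -> T -> T;
  imp_mono : forall a a' b b' : T,
    a' <= a -> b <= b' -> imp a b <= imp a' b';
  imp_inf : forall (a : T) (B : set T),
    imp a (inf B) = inf [set imp a b | b in B];
}.

#[short(type="implicativeStructureType")]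
HB.structure Definition ImplicativeStructure d :=
  { T of CompleteLattice_isImplicative d T & CompleteLattice d T }.

Reserved Notation "a ~~> b" (at level 60, right associativity).
Notation "a ~~> b" := (imp a b) : order_scope.

HB.mixin Record ImplicativeStructure_hasSeparator d T
    of ImplicativeStructure d T := {
  sep : set T;
  sep_up : forall a b : T, sep a -> a <= b -> sep b;
  sep_K : sep (inf [set c | exists a b : T, c = a ~~> b ~~> a]);
  sep_S : sep (inf [set e | exists a b c : T,
    e = (a ~~> b ~~> c) ~~> (a ~~> b) ~~> a ~~> c]);
  sep_mp : forall a b : T, sep (a ~~> b) -> sep a -> sep b;
}.

#[short(type="implicativeAlgebraType")]
HB.structure Definition ImplicativeAlgebra d :=
  { T of ImplicativeStructure_hasSeparator d T & ImplicativeStructure d T }.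

Section Connectives.
Context {d : Order.disp_t} {A : implicativeAlgebraType d}.

Definition iprod (a b : A) : A :=
  inf (range (fun x : A => (a ~~> b ~~> x) ~~> x)).

(* The quantifier [exists_(i in D) c i] over a subset [D] of the index type. *)
Definition iex {I : Type} (D : set I) (c : I -> A) : A :=
  inf (range (fun x : A => inf [set c i ~~> x | i in D] ~~> x)).

Definition valid {I : Type} (p : I -> A) : Prop := sep (inf (range p)).

Lemma valid_le (I : Type) (p q : I -> A) :
  (forall i, p i <= q i) -> valid p -> valid q.
Proof.
move=> pq /sep_up; apply; apply: inf_glb => _ [i _ <-].
by apply: le_trans (pq i); apply: inf_lb; exists i.
Qed.

Lemma valid_comp (I J : Type) (f : J -> I) (p : I -> A) :
  valid p -> valid (p \o f).
Proof.
move=> /sep_up; apply; apply: inf_glb => _ [j _ <-].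
by apply: inf_lb; exists (f j).
Qed.

Lemma valid_mp (I : Type) (p q : I -> A) :
  valid (fun i => p i ~~> q i) -> valid p -> valid q.
Proof.
move=> pq; apply: sep_mp; apply: sep_up pq _.
rewrite imp_inf; apply: inf_glb => _ [_ [i _ <-] <-].
apply: (le_trans (y := p i ~~> q i)); first by apply: inf_lb; exists i.
by apply: imp_mono => //; apply: inf_lb; exists i.
Qed.

Lemma valid_inf (I J : Type) (D : I -> set J) (p : I -> A) (q : I -> J -> A) :
  valid (fun ij : {i : I & {j : J | D i j}} =>
           p (projT1 ij) ~~> q (projT1 ij) (sval (projT2 ij))) ->
  valid (fun i => p i ~~> inf [set q i j | j in D i]).
Proof.
move=> /sep_up; apply; apply: inf_glb => _ [i _ <-].
rewrite imp_inf; apply: inf_glb => _ [_ [j Dj <-] <-].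
apply: inf_lb; exists (existT _ i (exist _ j Dj)) => //.
Qed.

Lemma valid_K (I : Type) (p q : I -> A) : valid (fun i => p i ~~> q i ~~> p i).
Proof.
apply: sep_up sep_K _; apply: inf_glb => _ [i _ <-].
by apply: inf_lb; exists (p i), (q i).
Qed.

Lemma valid_S (I : Type) (p q r : I -> A) :
  valid (fun i => (p i ~~> q i ~~> r i) ~~> (p i ~~> q i) ~~> p i ~~> r i).
Proof.
apply: sep_up sep_S _; apply: inf_glb => _ [i _ <-].
by apply: inf_lb; exists (p i), (q i), (r i).
Qed.

Lemma valid_weak (I : Type) (c p : I -> A) :
  valid p -> valid (fun i => c i ~~> p i).
Proof. exact: valid_mp (valid_K p c). Qed.

Lemma valid_mp1 (I : Type) (c p q : I -> A) :
  valid (fun i => c i ~~> p i ~~> q i) -> valid (fun i => c i ~~> p i) ->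
  valid (fun i => c i ~~> q i).
Proof. by move=> /(valid_mp (valid_S c p q)) /valid_mp; apply. Qed.

Lemma valid_mp2 (I : Type) (c h p q : I -> A) :
  valid (fun i => c i ~~> h i ~~> p i ~~> q i) ->
  valid (fun i => c i ~~> h i ~~> p i) -> valid (fun i => c i ~~> h i ~~> q i).
Proof.
move=> cpq; apply: valid_mp1; apply: valid_mp1 cpq.
by apply: valid_weak; exact: valid_S.
Qed.

Lemma valid_id (I : Type) (p : I -> A) : valid (fun i => p i ~~> p i).
Proof. by apply: valid_mp1 (valid_K p p); exact: (valid_K p (fun i => p i ~~> p i)). Qed.

Lemma valid_imp_le (I : Type) (p q : I -> A) :
  (forall i, p i <= q i) -> valid (fun i => p i ~~> q i).
Proof. by move=> pq; apply: valid_le (valid_id p) => i; exact: imp_mono. Qed.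

Lemma valid_trans (I : Type) (p q r : I -> A) :
  valid (fun i => p i ~~> q i) -> valid (fun i => q i ~~> r i) ->
  valid (fun i => p i ~~> r i).
Proof. by move=> pq qr; apply: valid_mp1 pq; exact: valid_weak. Qed.

Lemma valid_flip (I : Type) (p q r : I -> A) :
  valid (fun i => p i ~~> q i ~~> r i) -> valid q ->
  valid (fun i => p i ~~> r i).
Proof. by move=> pqr qv; apply: valid_mp1 pqr _; exact: valid_weak. Qed.

Lemma valid_iprodl (I : Type) (p q : I -> A) :
  valid (fun i => iprod (p i) (q i) ~~> p i).
Proof.
apply: valid_flip (valid_K p q); apply: valid_imp_le => i.
by apply: inf_lb; exists (p i).
Qed.

Lemma valid_iprodr (I : Type) (p q : I -> A) :
  valid (fun i => iprod (p i) (q i) ~~> q i).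
Proof.
apply: valid_flip (valid_weak p (valid_id q)); apply: valid_imp_le => i.
by apply: inf_lb; exists (q i).
Qed.

Lemma valid_iprod (I : Type) (c p q : I -> A) :
  valid (fun i => c i ~~> p i) -> valid (fun i => c i ~~> q i) ->
  valid (fun i => c i ~~> iprod (p i) (q i)).
Proof.
move=> cp cq; apply: valid_inf.
set IX : Type := sigT _; pose f (ix : IX) : I := projT1 ix.
pose x (ix : IX) : A := sval (projT2 ix).
have cp' : valid (fun ix => c (f ix) ~~> p (f ix)) by exact: (valid_comp f cp).
have cq' : valid (fun ix => c (f ix) ~~> q (f ix)) by exact: (valid_comp f cq).
pose h ix := p (f ix) ~~> q (f ix) ~~> x ix.
have weak2 r : valid (fun ix => c (f ix) ~~> r ix) ->
    valid (fun ix => c (f ix) ~~> h ix ~~> r ix).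
  by move=> cr; apply: valid_trans cr (valid_K r h).
apply: (@valid_mp2 IX (c \o f) h (q \o f) x); last exact: weak2.
apply: (@valid_mp2 IX (c \o f) h (p \o f) (fun ix => q (f ix) ~~> x ix)).
  by apply: valid_weak; exact: valid_id.
exact: weak2.
Qed.

End Connectives.

Section Tripos.
Context {d : Order.disp_t} (A : implicativeAlgebraType d).

Definition entails {I : Type} (phi psi : I -> A) : bool :=
  `[< valid (fun i => phi i ~~> psi i) >].

Lemma entails_refl (I : Type) : reflexive (@entails I).
Proof. by move=> phi; apply/asboolP; exact: valid_id. Qed.

Lemma entails_trans (I : Type) : transitive (@entails I).
Proof.
by move=> psi phi chi /asboolP h1 /asboolP h2; apply/asboolP; exact: valid_trans h1 h2.
Qed.

Definition interderivable {I : Type} (phi psi : {classic (I -> A)}) : bool :=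
  entails phi psi && entails psi phi.

Lemma interderivable_refl (I : Type) : reflexive (@interderivable I).
Proof. by move=> phi; rewrite /interderivable entails_refl. Qed.

Lemma interderivable_sym (I : Type) : symmetric (@interderivable I).
Proof. by move=> phi psi; rewrite /interderivable andbC. Qed.

Lemma interderivable_trans (I : Type) : transitive (@interderivable I).
Proof.
move=> psi phi chi /andP[? ?] /andP[? ?].
by apply/andP; split; apply: (@entails_trans _ psi).
Qed.

Canonical interderivable_equiv (I : Type) := EquivRel (@interderivable I)
  (@interderivable_refl I) (@interderivable_sym I) (@interderivable_trans I).

Definition tripos (I : SET) : Type :=
  {eq_quot @interderivable I}%qT.

HB.instance Definition _ (I : SET) := Choice.on (tripos I).
HB.instance Definition _ (I : SET) := EqQuotient.on (tripos I).

Definition cls {I : SET} (phi : I -> A) : tripos I :=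
  (\pi_(tripos I) (phi : {classic (I -> A)}))%qT.

Definition rep {I : SET} (phi : tripos I) : I -> A := (repr phi)%qT.

Lemma rep_cls (I : SET) (phi : I -> A) :
  entails (rep (cls phi)) phi /\ entails phi (rep (cls phi)).
Proof.
apply/andP; rewrite -/(interderivable (rep (cls phi)) phi).
by apply/eqmodP; rewrite /rep /cls reprK.
Qed.

Lemma repK (I : SET) : cancel (@rep I) (@cls I).
Proof. by move=> phi; rewrite /rep /cls reprK. Qed.

Definition tripos_le {I : SET} (phi psi : tripos I) : bool :=
  entails (rep phi) (rep psi).

Lemma tripos_le_cls (I : SET) (phi psi : I -> A) :
  tripos_le (cls phi) (cls psi) = entails phi psi.
Proof.
have [a b] := rep_cls phi; have [a' b'] := rep_cls psi.
apply/idP/idP => [h|h].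
  exact: entails_trans (entails_trans b h) a'.
exact: entails_trans (entails_trans a h) b'.
Qed.

Lemma tripos_le_refl (I : SET) : reflexive (@tripos_le I).
Proof. by move=> phi; exact: entails_refl. Qed.

Lemma tripos_le_anti (I : SET) : antisymmetric (@tripos_le I).
Proof.
move=> phi psi /andP[le1 le2]; rewrite -[phi]repK -[psi]repK.
by apply/eqmodP/andP.
Qed.

Lemma tripos_le_trans (I : SET) : transitive (@tripos_le I).
Proof. by move=> psi phi chi; exact: entails_trans. Qed.

Fact tripos_display : Order.disp_t. Proof. exact: Order.Disp tt tt. Qed.

HB.instance Definition _ (I : SET) := Order.Le_isPOrder.Build tripos_display
  (tripos I) (@tripos_le_refl I) (@tripos_le_anti I) (@tripos_le_trans I).

Lemma le_cls (I : SET) (phi psi : I -> A) :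
  (cls phi <= cls psi) = entails phi psi.
Proof. exact: tripos_le_cls. Qed.

(* The operations of the tripos are defined on chosen representatives; that they
   do not depend on the choice is [le_cls], [meet_cls], [pull_cls], [ex_cls]. *)
Definition trimeet {I : SET} (phi psi : tripos I) : tripos I :=
  cls (fun i => iprod (rep phi i) (rep psi i)).

Lemma tripos_lexI (I : SET) (chi phi psi : tripos I) :
  (chi <= trimeet phi psi) = (chi <= phi) && (chi <= psi).
Proof.
rewrite -[chi]repK -[X in _ = (_ <= X) && _]repK -[X in _ = _ && (_ <= X)]repK.
rewrite !le_cls; apply/asboolP/andP => [h|[/asboolP h1 /asboolP h2]].
  by split; apply/asboolP; apply: valid_trans h _;
    [exact: valid_iprodl|exact: valid_iprodr].
exact: valid_iprod.
Qed.

HB.instance Definition _ (I : SET) := Order.POrder_isMeetSemilattice.Build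
  tripos_display (tripos I) (@tripos_lexI I).

Lemma tripos_lex1 (I : SET) (phi : tripos I) : phi <= cls (fun=> inf set0).
Proof.
rewrite -[phi]repK le_cls; apply/asboolP; apply: valid_imp_le => i.
by apply: inf_glb.
Qed.

HB.instance Definition _ (I : SET) := Order.hasTop.Build
  tripos_display (tripos I) (@tripos_lex1 I).

Lemma meet_cls (I : SET) (phi psi : I -> A) :
  cls phi `&` cls psi = cls (fun i => iprod (phi i) (psi i)).
Proof.
apply/le_anti/andP; split; last first.
  rewrite lexI !le_cls; apply/andP.
  by split; apply/asboolP; [exact: valid_iprodl|exact: valid_iprodr].
set m := _ `&` _; rewrite -[m]repK le_cls; apply/asboolP.
have mE (chi : I -> A) : m <= cls chi -> valid (fun i => rep m i ~~> chi i).
  by rewrite -{1}[m]repK le_cls => /asboolP.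
by apply: valid_iprod; apply: mE; [exact: leIl|exact: leIr].
Qed.

Definition pull {I X : SET} (f : I -> X) (phi : tripos X) : tripos I :=
  cls (rep phi \o f).

Definition ex {I X : SET} (f : I -> X) (phi : tripos I) : tripos X :=
  cls (fun x => iex [set i | f i = x] (rep phi)).

Lemma entails_ex (I X : Type) (f : I -> X) (phi : I -> A) (psi : X -> A) :
  entails (fun x => iex [set i | f i = x] phi) psi = entails phi (psi \o f).
Proof.
apply/asboolP/asboolP => [h|h]; last first.
  pose g x := inf [set phi i ~~> psi x | i in [set i | f i = x]].
  apply: (@valid_flip _ _ _ _ g).
    by apply: valid_imp_le => x; apply: inf_lb; exists (psi x).
  move: h => /sep_up; apply; apply: inf_glb => _ [x _ <-].
  apply: inf_glb => _ [i /= <- <-].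
  by apply: inf_lb; exists i.
apply: valid_trans (valid_comp f h).
apply: valid_inf => /=; set IX : Type := sigT _.
pose p (ix : IX) := phi (projT1 ix); pose x (ix : IX) : A := sval (projT2 ix).
have pv : valid (fun ix => p ix ~~> (p ix ~~> x ix) ~~> x ix).
  apply: (@valid_mp2 _ _ _ p (fun ix => p ix ~~> x ix) p x).
    by apply: valid_weak; exact: valid_id.
  exact: valid_K.
apply: valid_le pv => ix; apply: imp_mono => //; apply: imp_mono => //.
by apply: inf_lb; exists (projT1 ix).
Qed.

Lemma pull_cls (I X : SET) (f : I -> X) (phi : X -> A) :
  pull f (cls phi) = cls (phi \o f).
Proof.
have [/asboolP a /asboolP b] := rep_cls phi.
apply/le_anti; rewrite !le_cls; apply/andP.
by split; apply/asboolP; [exact: (valid_comp f a)|exact: (valid_comp f b)].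
Qed.

Lemma le_ex (I X : SET) (f : I -> X) (phi : tripos I) (psi : tripos X) :
  (ex f phi <= psi) = (phi <= pull f psi).
Proof. by rewrite -{1}[psi]repK -{2}[phi]repK !le_cls entails_ex. Qed.

Lemma ex_cls (I X : SET) (f : I -> X) (phi : I -> A) :
  ex f (cls phi) = cls (fun x => iex [set i | f i = x] phi).
Proof.
apply/le_anti/andP; split.
  rewrite le_ex pull_cls le_cls -(@entails_ex _ _ f).
  exact: entails_refl.
rewrite -[ex f _]repK le_cls entails_ex -le_cls -pull_cls repK.
by rewrite -le_ex.
Qed.

Definition delta (X : SET) : tripos (X * X)%type :=
  ex (fun x : X => (x, x)) \top.

Definition functional {I J : SET} (phi : tripos (I * J)%type) : Prop :=
  pull (fun t : (I * J * J)%type => (t.1.1, t.1.2)) phi `&`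
  pull (fun t : (I * J * J)%type => (t.1.1, t.2)) phi
    <= pull (fun t : (I * J * J)%type => (t.1.2, t.2)) (delta J).

Definition fSKp {I : SET} (phi : tripos I) : Prop :=
  forall (J : SET) (psi : tripos (I * J)%type),
    functional psi -> phi <= ex fst psi ->
    exists! f : I -> J, phi <= pull (fun i => (i, f i)) psi.

Record regObj := RegObj {
  reg_set : SET;
  reg_pred : tripos reg_set;
}.

Record regHom (a b : regObj) := RegHom {
  hom_pred : tripos (reg_set a * reg_set b)%type;
  hom_le : hom_pred <= pull fst (reg_pred a) `&` pull snd (reg_pred b);
  hom_total : reg_pred a <= ex fst hom_pred;
  hom_functional : functional hom_pred;
}.

Definition strongly_trackable_hom {a b : regObj} (phi : regHom a b) : Prop :=
  exists! f : reg_set a -> reg_set b,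
    reg_pred a <= pull (fun x => (x, f x)) (hom_pred phi).

Definition strongly_trackable (a : regObj) : Prop :=
  forall (b : regObj) (phi : regHom a b), strongly_trackable_hom phi.

End Tripos.

(* Main.v *)
(** A functional [psi] on [I * J] with [alpha <= ex fst psi] need not lie below
    [pull fst alpha], but its restriction [psi `&` pull fst alpha] is an arrow
    [(I, alpha) -> (J, \top)] of [Reg P]: totality is Frobenius reciprocity.
    Since [fst \o <id, f> = id], a function tracks this arrow on [alpha] exactly
    when it tracks [psi]. *)

Require Import Defs.
From mathcomp Require Import all_order.
From mathcomp Require Import ssreflect ssrfun ssrbool eqtype.
From mathcomp Require Import boolp classical_sets.

Set Implicit Arguments.
Unset Strict Implicit.
Unset Printing Implicit Defensive.

Import Order.TTheory.
Local Open Scope classical_set_scope.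
Local Open Scope order_scope.

Section Validity.
Context {d : Order.disp_t} {A : implicativeAlgebraType d}.

Lemma valid_mp_swap (I : Type) (p q : I -> A) :
  valid (fun i => p i ~~> (p i ~~> q i) ~~> q i).
Proof.
apply: (@valid_mp2 _ _ _ p (fun i => p i ~~> q i) p q).
  by apply: valid_weak; exact: valid_id.
exact: valid_K.
Qed.

(** S distributes the first hypothesis over [p], and K turns [q] into a function constant in [p]. *)
Lemma valid_C (I : Type) (p q r : I -> A) :
  valid (fun i => (p i ~~> q i ~~> r i) ~~> q i ~~> p i ~~> r i).
Proof.
apply: (@valid_mp2 _ _ _ _ q (fun i => p i ~~> q i)); last first.
  by apply: valid_weak; exact: valid_K.
apply: (@valid_mp2 _ _ _ _ q (fun i => p i ~~> q i ~~> r i)).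
  by apply: valid_weak; apply: valid_weak; exact: valid_S.
exact: valid_K.
Qed.

Lemma valid_pair (I : Type) (p q : I -> A) :
  valid (fun i => p i ~~> q i ~~> iprod (p i) (q i)).
Proof.
(* [iprod] is an infimum over all [x], so validity is established uniformly over pairs [(i, x)];
   [imp_inf] then moves the infimum outside both implications. *)
pose IX : Type := (I * A)%type.
pose P (z : IX) := p z.1; pose Q (z : IX) := q z.1.
have : valid (fun z : IX => P z ~~> Q z ~~> (P z ~~> Q z ~~> z.2) ~~> z.2).
  apply: valid_trans (valid_C _ _ _).
  exact: valid_mp_swap.
move=> /sep_up; apply; apply: inf_glb => _ [i _ <-].
rewrite /iprod !imp_inf; apply: inf_glb => _ [_ [_ [x _ <-] <-] <-].
by apply: inf_lb; exists (i, x).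
Qed.

Lemma valid_curry (I : Type) (p q r : I -> A) :
  valid (fun i => iprod (p i) (q i) ~~> r i) ->
  valid (fun i => p i ~~> q i ~~> r i).
Proof.
move=> pqr; apply: (@valid_mp2 _ _ _ p q (fun i => iprod (p i) (q i))).
  by apply: valid_weak; exact: valid_weak.
exact: valid_pair.
Qed.

End Validity.

Section Predicates.
Context {d : Order.disp_t} {A : implicativeAlgebraType d}.

Lemma pull_id (I : SET) (phi : tripos A I) : pull id phi = phi.
Proof. exact: repK. Qed.

Lemma pull_comp (I J K : SET) (f : I -> J) (g : J -> K) (phi : tripos A K) :
  pull f (pull g phi) = pull (g \o f) phi.
Proof. by rewrite -[phi]repK !pull_cls. Qed.

Lemma pull_mono (I J : SET) (f : I -> J) (phi psi : tripos A J) :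
  phi <= psi -> pull f phi <= pull f psi.
Proof.
rewrite -[phi]repK -[psi]repK !pull_cls !le_cls => /asboolP le_pq.
by apply/asboolP; exact: (valid_comp f le_pq).
Qed.

Lemma pull_meet (I J : SET) (f : I -> J) (phi psi : tripos A J) :
  pull f (phi `&` psi) = pull f phi `&` pull f psi.
Proof. by rewrite -[phi]repK -[psi]repK meet_cls !pull_cls meet_cls. Qed.

(** Meeting with [alpha] is left adjoint to implication out of [alpha], and [pull f] preserves
    implication since both act pointwise. Currying and transposing along [f] therefore reduce the
    claim to an inequality over [I]. *)
Lemma frobenius_le (I J : SET) (f : I -> J) (phi : tripos A I)
    (alpha : tripos A J) :
  ex f phi `&` alpha <= ex f (phi `&` pull f alpha).
Proof.
set chi := ex f (phi `&` pull f alpha).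
(* The unit of the adjunction between [ex f] and [pull f]. *)
have : phi `&` pull f alpha <= pull f chi by rewrite -le_ex.
rewrite -[phi]repK -[alpha]repK -[chi]repK !pull_cls meet_cls le_cls.
set p := rep phi; set a := rep alpha; set c := rep chi.
move=> /asboolP /valid_curry pac.
have : ex f (cls p) <= cls (fun j => a j ~~> c j).
  by rewrite le_ex pull_cls le_cls; apply/asboolP.
move: (ex f (cls p)) => e; rewrite -[e]repK meet_cls !le_cls => /asboolP eac.
apply/asboolP; apply: valid_mp1 (valid_iprodr _ _).
exact: valid_trans (valid_iprodl _ _) eac.
Qed.

(** Passing to [phi] shrinks the meet of the two pullbacks, while the bound [delta J] stays
    fixed. *)
Lemma functional_le (I J : SET) (phi psi : tripos A (I * J)%type) :
  phi <= psi -> functional psi -> functional phi.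
Proof.
by move=> le_phi; apply: le_trans; apply: leI2; exact: pull_mono.
Qed.

Section Restriction.
Variables (I J : SET) (alpha : tripos A I) (psi : tripos A (I * J)%type).
Hypotheses (psi_fun : functional psi) (psi_total : alpha <= ex fst psi).

Let phi : tripos A (I * J)%type := psi `&` pull fst alpha.

Lemma restriction_le : phi <= pull fst alpha `&` pull snd (\top : tripos A J).
Proof.
(* [\top] unfolds to the class of a constant map, so its pullback is again [\top] up to
   conversion. *)
by rewrite lexI leIr -[pull _ \top]/(pull _ (cls _)) pull_cls; exact: lex1.
Qed.

Lemma restriction_total : alpha <= ex fst phi.
Proof. by apply: le_trans (frobenius_le _ _ _); rewrite lexI psi_total lexx. Qed.

Lemma restriction_functional : functional phi.
Proof. by apply: functional_le psi_fun; exact: leIl. Qed.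

Definition restriction_hom : regHom (RegObj alpha) (RegObj (\top : tripos A J)) :=
  @RegHom _ _ (RegObj alpha) (RegObj \top) phi
    restriction_le restriction_total restriction_functional.

(** Holding for every [f], this transfers both existence and uniqueness of the tracking function. *)
Lemma le_pull_restriction (f : I -> J) :
  (alpha <= pull (fun i => (i, f i)) phi) =
  (alpha <= pull (fun i => (i, f i)) psi).
Proof. by rewrite pull_meet pull_comp lexI pull_id lexx andbT. Qed.

End Restriction.
End Predicates.

Theorem proposition5p29 (d : Order.disp_t) (A : implicativeAlgebraType d)
    (X : SET) (alpha : tripos A X) :
  strongly_trackable (RegObj alpha) <-> fSKp alpha.
Proof.
split=> [track J psi psi_fun psi_total | alpha_fSK b phi].
  have [f [f_track f_uniq]] := track _ (restriction_hom psi_fun psi_total).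
  exists f; split; first by rewrite -le_pull_restriction.
  by move=> g g_track; apply: f_uniq; rewrite /= le_pull_restriction.
(* Conversely, the predicate of an arrow is already functional and total on [alpha], so
   supercompactness applies to it directly. *)
exact: alpha_fSK (hom_functional phi) (hom_total phi).
Qed.
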